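(* Let $X$ and $Y$ be locally compact Hausdorff spaces. Let $T\colon C_0^+(X) \to C_0^+(Y)$ be a ring isomorphism in norm, that is, a bijective map that, for all $f, g \in C_0^+(X)$, satisfies $$\Vert T(f+g)\Vert = \Vert T(f)+T(g)\Vert, \qquad \Vert T(f\cdot g)\Vert = \Vert T(f)\cdot T(g)\Vert.$$ Then there exists a homeomorphism $\tau\colon Y \to X$ such that $$T(f)(y) = f(\tau(y)) \quad \text{for all } f \in C_0^+(X) \text{ and all } y \in Y.$$
   Context: For a locally compact Hausdorff space $X$, $C_0(X)$ denotes the Banach algebra of all real-valued continuous functions on $X$ vanishing at infinity, with pointwise operations and the supremum norm $\Vert\cdot\Vert$ (if $X$ is compact, $C_0(X)=C(X)$). Its positive cone is $C_0^+(X) = \{ f \in C_0(X) : f(x)\ge 0 \text{ for all } x\in X\}$. Products and sums of functions are pointwise. No continuity, additivity or homogeneity of $T$ is assumed. *)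

(* Defs.v *)
From mathcomp Require Import all_boot all_order all_algebra.
From mathcomp Require Import all_classical all_reals all_analysis.
Import Order.TTheory GRing.Theory Num.Theory.
Import numFieldNormedType.Exports.

Set Implicit Arguments.
Unset Strict Implicit.
Unset Printing Implicit Defensive.

Local Open Scope classical_set_scope.
Local Open Scope ring_scope.

Definition vanishes_at_infinity {R : realType} {X : topologicalType}
    (f : X -> R) : Prop :=
  forall e : R, 0 < e -> compact [set x | e <= `|f x|].

Definition C0 (R : realType) (X : topologicalType) : set (X -> R) :=
  [set f | continuous f /\ vanishes_at_infinity f].
Arguments C0 : clear implicits.

Definition C0pos (R : realType) (X : topologicalType) : set (X -> R) :=
  [set f | C0 R X f /\ forall x, 0 <= f x].
Arguments C0pos : clear implicits.

(* [sup] is 0 on the empty set, so the norm on the zero space C0(X) with X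
   empty is 0; otherwise this is a genuine supremum for f in C0(X), since
   such an f is bounded. *)
Definition supnorm {R : realType} {X : Type} (f : X -> R) : R :=
  sup [set `|f x| | x in [set: X]].

(* A map C0^+(X) -> C0^+(Y) is represented by a total function T on X -> R,
   of which only the restriction to [C0pos R X] matters: [set_bij] says that
   this restriction takes its values in [C0pos R Y] and is a bijection onto it,
   and [C0pos R X] is stable under pointwise sums and products. *)
Definition ring_isomorphism_in_norm {R : realType} {X Y : topologicalType}
    (T : (X -> R) -> (Y -> R)) : Prop :=
  [/\ set_bij (C0pos R X) (C0pos R Y) T,
      forall f g, C0pos R X f -> C0pos R X g ->
        supnorm (T (f \+ g)) = supnorm (T f \+ T g) &
      forall f g, C0pos R X f -> C0pos R X g ->
        supnorm (T (f \* g)) = supnorm (T f \* T g)].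

Definition homeomorphism {X Y : topologicalType} (f : X -> Y) : Prop :=
  exists g : Y -> X,
    [/\ cancel f g, cancel g f, continuous f & continuous g].

(* Main.v *)
Require Import Defs.
From mathcomp Require Import all_boot all_order all_algebra.
From mathcomp Require Import all_classical all_reals all_analysis.
From mathcomp Require Import lra.
Import Order.TTheory GRing.Theory Num.Theory.
Import numFieldNormedType.Exports.

Set Implicit Arguments.
Unset Strict Implicit.

Local Open Scope classical_set_scope.
Local Open Scope ring_scope.

(* Multiplying by bump functions localizes the two norm identities: comparing
   ||T(f) T(k)|| = ||T(f k)|| over all k in the cone shows that T preserves and
   reflects the pointwise order, that T(n f) = n T(f), and that f <= 1 if and
   only if T(f) <= 1. These properties pass to the inverse of T. A compactness
   argument then gives, for each y, a point x with T(f)(y) <= f(x) for all f,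
   and the same argument for the inverse gives for each x a point y' with
   f(x) <= T(f)(y'). Chaining both, T(f)(y) <= T(f)(y') for all f, so y' = y
   and T(f)(y) = f(x). *)

(** * The cone of nonnegative functions vanishing at infinity *)

Section PositiveCone.
Context {R : realType} {X : topologicalType}.
Implicit Types f g h u v : X -> R.

Lemma closed_superlevel f (c : R) : continuous f -> closed [set x | c <= f x].
Proof.
move=> fc; apply: (@closed_comp _ _ f [set r | c <= r]); last exact: closed_ge.
by move=> x _; exact: fc.
Qed.

Lemma open_ltfun f g : continuous f -> continuous g -> open [set x | f x < g x].
Proof.
move=> fc gc; rewrite (_ : mkset _ = (g \- f) @^-1` [set r | 0 < r]).
  apply: open_comp; last exact: open_gt.
  by move=> x _; apply: continuousB; [exact: gc|exact: fc].
by apply/seteqP; split=> x /=; rewrite subr_gt0.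
Qed.

Lemma C0pos_ge0 f : C0pos R X f -> forall x, 0 <= f x.
Proof. by case. Qed.

Lemma C0pos_continuous f : C0pos R X f -> continuous f.
Proof. by case=> -[]. Qed.

Lemma C0pos_compact f e : C0pos R X f -> 0 < e -> compact [set x | e <= f x].
Proof.
move=> [[_ fv] f0] e0; rewrite (_ : mkset _ = [set x | e <= `|f x|]); first exact: fv.
by apply/seteqP; split=> x /=; rewrite ger0_norm.
Qed.

(** Superlevel sets of a continuous function are closed, so enclosing each one in a compact set
    already makes it compact. *)
Lemma C0posI h : continuous h -> (forall x, 0 <= h x) ->
  (forall e, 0 < e -> exists2 K, compact K & [set x | e <= h x] `<=` K) ->
  C0pos R X h.
Proof.
move=> hc h0 hK; split=> //; split=> // e e0.
have [K Kc hKe] := hK e e0.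
apply: (@subclosed_compact _ _ K) => //.
  rewrite (_ : mkset _ = [set x | e <= h x]); first exact: closed_superlevel.
  by apply/seteqP; split=> x /=; rewrite ger0_norm.
by move=> x /=; rewrite ger0_norm// => /hKe.
Qed.

Lemma C0pos_le f h : C0pos R X f -> continuous h ->
  (forall x, 0 <= h x <= f x) -> C0pos R X h.
Proof.
move=> Cf hc hf; apply: C0posI => //; first by move=> x; have /andP[] := hf x.
move=> e e0; exists [set x | e <= f x]; first exact: C0pos_compact.
by move=> x /= /le_trans; apply; have /andP[] := hf x.
Qed.

Lemma C0pos0 : C0pos R X (fun=> 0).
Proof.
apply: C0posI => //; first by move=> x; exact: cvg_cst.
by move=> e e0; exists set0; [exact: compact0|move=> x /=; rewrite leNgt e0].
Qed.

Lemma C0posD f g : C0pos R X f -> C0pos R X g -> C0pos R X (f \+ g).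
Proof.
move=> Cf Cg; apply: C0posI.
- by move=> x; apply: continuousD; exact: C0pos_continuous.
- by move=> x; rewrite addr_ge0// C0pos_ge0.
move=> e e0; have e20 : 0 < e / 2 by rewrite divr_gt0.
exists ([set x | e / 2 <= f x] `|` [set x | e / 2 <= g x]).
  by apply: compactU; exact: C0pos_compact.
move=> x /= efg; apply/orP; rewrite !leNgt -negb_and; apply/negP => /andP[].
lra.
Qed.

Lemma C0posZ (c : R) f : 0 <= c -> C0pos R X f -> C0pos R X (fun x => c * f x).
Proof.
move=> c0 Cf; apply: C0posI.
- move=> x; apply: (@continuousM _ _ (fun=> c) f); first exact: cvg_cst.
  exact: C0pos_continuous.
- by move=> x; rewrite mulr_ge0// C0pos_ge0.
(* [c] may be 0, so the level is divided by [c + 1] instead. *)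
move=> e e0; have c10 : 0 < c + 1 by lra.
exists [set x | e / (c + 1) <= f x].
  by apply: C0pos_compact => //; rewrite divr_gt0.
move=> x /= ecf; rewrite ler_pdivrMr//.
have := C0pos_ge0 Cf x; lra.
Qed.

(** [f] is bounded on the compact set where it is at least 1, and below 1 elsewhere. *)
Lemma C0pos_bounded f : C0pos R X f -> exists2 M, 0 <= M & forall x, f x <= M.
Proof.
move=> Cf; have : bounded_set (f @` [set x | 1 <= f x]).
  apply: compact_bounded; apply: continuous_compact.
    by apply: continuous_subspaceT; exact: C0pos_continuous.
  exact: C0pos_compact.
move=> [M [_ MP]]; pose N := Num.max 1 (M + 1); exists N.
  by rewrite le_max ler01.
move=> x; rewrite le_max; have [//|fx] := leP (f x) 1.
have /(MP (M + 1)) : M < M + 1 by lra.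
by move=> /(_ (f x)) ; rewrite /= ger0_norm ?C0pos_ge0//; apply; exists x => //=; exact: ltW.
Qed.

Lemma C0posM f g : C0pos R X f -> C0pos R X g -> C0pos R X (f \* g).
Proof.
move=> Cf Cg; have [M M0 fM] := C0pos_bounded Cf.
apply: (C0pos_le (C0posZ M0 Cg)).
  by move=> x; apply: continuousM; exact: C0pos_continuous.
move=> x /=; rewrite mulr_ge0 ?C0pos_ge0//=.
by rewrite ler_wpM2r// C0pos_ge0.
Qed.

Lemma C0pos_min f g : C0pos R X f -> C0pos R X g -> C0pos R X (f \min g).
Proof.
move=> Cf Cg; apply: (C0pos_le Cf).
  by move=> x; apply: continuous_min; exact: C0pos_continuous.
by move=> x /=; rewrite le_min !C0pos_ge0//= ge_min lexx.
Qed.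

Lemma C0pos_sub f g : C0pos R X f -> C0pos R X g -> (forall x, f x <= g x) ->
  C0pos R X (g \- f).
Proof.
move=> Cf Cg fg; apply: (C0pos_le Cg).
  by move=> x; apply: continuousB; exact: C0pos_continuous.
move=> x /=; rewrite subr_ge0 fg /=.
have := C0pos_ge0 Cf x; lra.
Qed.

(** * The supremum norm on the cone *)

Lemma supnorm_ge f x : C0pos R X f -> f x <= supnorm f.
Proof.
move=> Cf; apply: (@le_trans _ _ `|f x|); first exact: ler_norm.
apply: ub_le_sup; last by exists x.
have [M M0 fM] := C0pos_bounded Cf; exists M => _ [z _ <-].
by rewrite ger0_norm ?C0pos_ge0.
Qed.

Lemma supnorm_ge0 f : C0pos R X f -> 0 <= supnorm f.
Proof.
move=> Cf; have [[x _]|/set0P/negP/negPn/eqP X0] := pselect ([set: X] !=set0).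
  exact: le_trans (C0pos_ge0 Cf x) (supnorm_ge x Cf).
(* On an empty space the supremum runs over the empty set, where [sup] is 0. *)
by rewrite /supnorm X0 image_set0 sup0.
Qed.

Lemma supnorm_le f M : (forall x, 0 <= f x) -> 0 <= M -> (forall x, f x <= M) ->
  supnorm f <= M.
Proof.
move=> f0 M0 fM; have [[x _]|/set0P/negP/negPn/eqP X0] := pselect ([set: X] !=set0).
  apply: ge_sup; first by exists `|f x|, x.
  by move=> _ [z _ <-]; rewrite ger0_norm.
by rewrite /supnorm X0 image_set0 sup0.
Qed.

Lemma le_supnorm f g : C0pos R X g -> (forall x, 0 <= f x <= g x) ->
  supnorm f <= supnorm g.
Proof.
move=> Cg fg; apply: supnorm_le; first by move=> x; have /andP[] := fg x.
  exact: supnorm_ge0.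
move=> x; have /andP[_ /le_trans] := fg x; apply; exact: supnorm_ge.
Qed.

Lemma supnormZ (c : R) f : 0 <= c -> C0pos R X f ->
  supnorm (fun x => c * f x) = c * supnorm f.
Proof.
rewrite le_eqVlt => /predU1P[<- Cf|c0 Cf].
  rewrite mul0r; apply/eqP; rewrite eq_le supnorm_ge0 ?andbT.
    by apply: supnorm_le => // x; rewrite mul0r.
  by apply: C0posZ.
have Ccf := C0posZ (ltW c0) Cf.
apply/eqP; rewrite eq_le; apply/andP; split.
  apply: supnorm_le; first exact: C0pos_ge0.
    by rewrite mulr_ge0 ?supnorm_ge0 ?ltW.
  by move=> x; rewrite ler_pM2l// supnorm_ge.
rewrite mulrC -ler_pdivlMr//; apply: supnorm_le; first exact: C0pos_ge0.
  by rewrite divr_ge0 ?supnorm_ge0 ?ltW.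
by move=> x; rewrite ler_pdivlMr// mulrC; exact: (supnorm_ge x Ccf).
Qed.

(** * Bump functions and what they detect *)

Hypotheses (X_lc : locally_compact [set: X]) (X_T2 : hausdorff_space X).

(** Complete regularity separates [x] from the complement of [V], the part of [U] interior to a
    compact neighbourhood [K'] of [x]. The bump is 1 minus the separating function, and its
    superlevel sets lie in [K']. *)
Lemma C0pos_bump (x : X) (U : set X) : open U -> U x ->
  exists k, [/\ C0pos R X k, k x = 1, forall z, k z <= 1 &
                forall z, ~ U z -> k z = 0].
Proof.
move=> oU Ux; have [K' xK' [K'c K'cl]] := @X_lc x I.
have {xK'} xK : nbhs x K' by move: xK'; rewrite /within /=; apply: filterS => z; exact.
pose V := U `&` K'^°.
have oV : open V by apply: openI => //; exact: open_interior.
have Vx : V x by split => //; exact: xK.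
have cB : closed (~` V) by exact: open_closedC.
have nB : ~ (~` V) x by move=> /(_ Vx).
have /(@uniform_separatorP X R)[p [pc p01 px pB]] :=
  @locally_compact_completely_regular X R X_lc X_T2 x _ cB nB.
have p01' z : 0 <= p z <= 1.
  by have := p01 (p z); rewrite /= in_itv /=; apply; exists z.
have k0 z : ~ V z -> 1 - p z = 0.
  by move=> Vz; rewrite (pB (p z)) ?subrr//; exists z.
exists (fun z => 1 - p z); split.
- apply: C0posI.
  + move=> z; apply: cvgB; first exact: cvg_cst.
    exact: pc.
  + by move=> z; rewrite subr_ge0; have /andP[] := p01' z.
  move=> e e0; exists K' => // z /= ez; apply: contrapT => K'z.
  have : 1 - p z = 0 by apply: k0 => -[_ /interior_subset].
  lra.
- by rewrite (px (p x)) ?subr0//; exists x.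
- by move=> z; have /andP[] := p01' z; lra.
- by move=> z Uz; apply: k0 => -[].
Qed.

(** If v(x) < c < u(x), a bump [k] at [x] that vanishes off {v < c} gives ||v k|| <= c < u(x) <= ||u
    k||. Asking only continuity and nonnegativity of [v] admits the constant 1. *)
Lemma C0pos_le_of_supnorm u v : C0pos R X u -> continuous v ->
    (forall x, 0 <= v x) ->
    (forall k, C0pos R X k -> supnorm (u \* k) <= supnorm (v \* k)) ->
  forall x, u x <= v x.
Proof.
move=> Cu vc v0 uv x; rewrite leNgt; apply/negP => vux.
pose c := (u x + v x) / 2; have [vxc cux] : v x < c /\ c < u x by rewrite /c; lra.
have oU : open [set z | v z < c] by apply: open_ltfun; [exact: vc|move=> z; exact: cvg_cst].
have [k [Ck kx k1 kU]] := C0pos_bump oU vxc.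
have : supnorm (v \* k) <= c.
  have c0 : 0 <= c by have := v0 x; lra.
  apply: supnorm_le => // z /=; first by rewrite mulr_ge0 ?v0 ?(C0pos_ge0 Ck).
  have kz := C0pos_ge0 Ck z; have := v0 z; have := k1 z.
  have [zU|/kU ->] := pselect (v z < c); last by rewrite mulr0.
  by nra.
have := supnorm_ge x (C0posM Cu Ck); rewrite /= kx mulr1.
have := uv k Ck; lra.
Qed.

Lemma C0pos_separates (x x' : X) :
  (forall f, C0pos R X f -> f x <= f x') -> x = x'.
Proof.
move=> fxx'; apply: contrapT => xx'.
have oU : open (~` [set x']).
  rewrite openC; apply: accessible_closed_set1; exact: hausdorff_accessible.
have [k [/fxx' + kx _ kU]] := C0pos_bump oU xx'.
by rewrite kx kU ?ler10// => /(_ erefl).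
Qed.

End PositiveCone.

(** Bumps make the sets {k > 0} a neighbourhood base in [X], so the cone determines its topology. *)
Lemma continuous_C0pos {R : realType} {X Y : topologicalType}
    (X_lc : locally_compact [set: X]) (X_T2 : hausdorff_space X) (tau : Y -> X) :
  (forall f, C0pos R X f -> continuous (f \o tau)) -> continuous tau.
Proof.
move=> ftau y U /= /[dup] Uy; rewrite {1}nbhsE => -[V [oV Vy] VU].
have [k [Ck ky k1 kV]] := C0pos_bump (R := R) X_lc X_T2 oV Vy.
have oW : open [set z | 0 < (k \o tau) z].
  by apply: open_ltfun; [move=> z; exact: cvg_cst|exact: ftau].
have : nbhs y [set z | 0 < (k \o tau) z].
  by apply: open_nbhs_nbhs; split => //=; rewrite ky.
apply: filterS => z /= kz; apply: VU; apply: contrapT => /kV.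
lra.
Qed.

(* Closed under taking inverses, unlike [ring_isomorphism_in_norm] as it
   stands. *)
Definition unital_order_isomorphism {R : realType} {X Y : topologicalType}
    (T : (X -> R) -> (Y -> R)) : Prop :=
  [/\ set_bij (C0pos R X) (C0pos R Y) T,
      forall f g, C0pos R X f -> C0pos R X g ->
        (forall x, f x <= g x) <-> (forall y, T f y <= T g y),
      forall n f, C0pos R X f ->
        T (fun x => n.+1%:R * f x) = (fun y => n.+1%:R * T f y) &
      forall f, C0pos R X f ->
        (forall x, f x <= 1) <-> (forall y, T f y <= 1)].

(** * From the two norm identities to order, integer multiples and the unit ball *)

Section NormToOrder.
Context {R : realType} {X Y : topologicalType}.
Hypotheses (X_lc : locally_compact [set: X]) (X_T2 : hausdorff_space X).
Hypotheses (Y_lc : locally_compact [set: Y]) (Y_T2 : hausdorff_space Y).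
Context (T : (X -> R) -> (Y -> R)).
Hypothesis T_iso : ring_isomorphism_in_norm T.
Implicit Types f g h k : X -> R.

Local Notation A := (C0pos R X).
Local Notation B := (C0pos R Y).

Lemma norm_iso_C0pos f : A f -> B (T f).
Proof. by case: T_iso => -[+ _ _] _ _; apply. Qed.

Lemma norm_iso_inj f g : A f -> A g -> T f = T g -> f = g.
Proof. by case: T_iso => -[_ + _] _ _ Af Ag; apply; rewrite inE. Qed.

Lemma norm_iso_surj u : B u -> exists2 f, A f & T f = u.
Proof. by case: T_iso => -[_ _ +] _ _ => /[apply]. Qed.

Lemma norm_isoD f g : A f -> A g -> supnorm (T (f \+ g)) = supnorm (T f \+ T g).
Proof. by case: T_iso => _ + _; apply. Qed.

Lemma norm_isoM f g : A f -> A g -> supnorm (T (f \* g)) = supnorm (T f \* T g).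
Proof. by case: T_iso => _ _; apply. Qed.

(** By surjectivity every test function on [Y] is some [T k], and ||T(f) T(k)|| = ||T(f k)||. *)
Lemma norm_iso_le_of_supnorm f (v : Y -> R) : A f -> continuous v ->
    (forall y, 0 <= v y) ->
    (forall k, A k -> supnorm (T (f \* k)) <= supnorm (v \* T k)) ->
  forall y, T f y <= v y.
Proof.
move=> Af vc v0 fv; apply: C0pos_le_of_supnorm => //; first exact: norm_iso_C0pos.
by move=> u /norm_iso_surj[k Ak <-]; rewrite -norm_isoM// fv.
Qed.

(** Write g = f + (g - f) with g - f in the cone: ||T(g)|| = ||T(f) + T(g - f)||, and the second
    summand is nonnegative. *)
Lemma norm_iso_supnorm_le f g : A f -> A g -> (forall x, f x <= g x) ->
  supnorm (T f) <= supnorm (T g).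
Proof.
move=> Af Ag fg; have Agf := C0pos_sub Af Ag fg.
rewrite [in leRHS](_ : g = f \+ (g \- f)); last first.
  by apply/funext => x /=; rewrite addrC subrK.
rewrite norm_isoD//; apply: le_supnorm.
  by apply: C0posD; exact: norm_iso_C0pos.
move=> y /=; rewrite C0pos_ge0 ?lerDl ?C0pos_ge0//; exact: norm_iso_C0pos.
Qed.

(** Induction, splitting (n + 2) f k as (n + 1) f k + f k. The induction hypothesis, applied to f k,
    gives ||T((n + 2) f k)|| = ||(n + 2) T(f) T(k)|| for every [k], and testing against all [k]
    gives both pointwise inequalities. *)
Lemma norm_isoZ n f : A f ->
  T (fun x => n.+1%:R * f x) = (fun y => n.+1%:R * T f y).
Proof.
elim: n f => [f _|n IHn f Af].
  by under eq_fun do rewrite mul1r; apply/funext => y; rewrite mul1r.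
pose m : R := n.+2%:R; have m0 : 0 <= m by [].
have Amf : A (fun x => m * f x) := C0posZ m0 Af.
have BTf := norm_iso_C0pos Af; have BmTf := C0posZ m0 BTf.
have BTmf := norm_iso_C0pos Amf.
have eqn k : A k ->
    supnorm (T ((fun x => m * f x) \* k)) = supnorm ((fun y => m * T f y) \* T k).
  move=> Ak; have Afk := C0posM Af Ak; have BTk := norm_iso_C0pos Ak.
  have BTfk := norm_iso_C0pos Afk.
  rewrite (_ : _ \* k = (fun x => n.+1%:R * (f \* k) x) \+ (f \* k)); last first.
    by apply/funext => x /=; rewrite -[m]natr1 -mulrA mulrDl mul1r.
  rewrite norm_isoD//; last by apply: C0posZ.
  rewrite IHn// (_ : _ \+ _ = (fun y => m * T (f \* k) y)); last first.
    by apply/funext => y /=; rewrite -[m]natr1 mulrDl mul1r.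
  rewrite supnormZ// norm_isoM// -supnormZ//; last exact: C0posM.
  by congr supnorm; apply/funext => y /=; rewrite mulrA.
apply/funext => y; apply/eqP; rewrite eq_le; apply/andP; split; move: y.
  apply: norm_iso_le_of_supnorm => //; first exact: C0pos_continuous.
    exact: C0pos_ge0.
  by move=> k /eqn ->.
apply: C0pos_le_of_supnorm => //; first exact: C0pos_continuous.
  exact: C0pos_ge0.
by move=> _ /norm_iso_surj[k Ak <-]; rewrite -norm_isoM// eqn.
Qed.

(** From 0 + 0 = 0, ||T(0)|| = 2 ||T(0)||, so T(0) = 0 and injectivity applies. *)
Lemma norm_iso_eq0 f : A f -> supnorm (T f) = 0 -> f = (fun=> 0).
Proof.
move=> Af Tf0; apply: norm_iso_inj => //; first exact: C0pos0.
have eq0 g : A g -> supnorm (T g) = 0 -> T g = (fun=> 0).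
  move=> /norm_iso_C0pos BTg Tg0; apply/funext => y; apply/eqP.
  by rewrite eq_le C0pos_ge0// andbT -Tg0 supnorm_ge.
have A0 := @C0pos0 R X; have BT0 := norm_iso_C0pos A0.
have := norm_isoD A0 A0; rewrite (_ : _ \+ _ = fun=> 0); last first.
  by apply/funext => x /=; rewrite addr0.
rewrite (_ : _ \+ _ = fun y => 2 * T (fun=> 0) y); last first.
  by apply/funext => y /=; rewrite -mulr2n mulr_natl.
rewrite supnormZ// => N0; rewrite (eq0 f)// (eq0 (fun=> 0))//; lra.
Qed.

(* [g] need not lie in the cone: besides cone elements, the lemma is applied
   to the constant 1. Were f(x) > g(x), then n f >= (n + 1) g would hold near x
   for some n, and multiplying by a bump k there gives
   n ||T(f k)|| >= (n + 1) ||T(g k)|| >= (n + 1) ||T(f k)||. *)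
Lemma norm_iso_reflect f g : A f -> continuous g -> (forall x, 0 <= g x) ->
    (forall k, A k -> A (g \* k)) ->
    (forall k, A k -> supnorm (T (f \* k)) <= supnorm (T (g \* k))) ->
  forall x, f x <= g x.
Proof.
move=> Af gc g0 gA fg x; rewrite leNgt; apply/negP => gfx.
(* This bound says (n + 2) g(x) < (n + 1) f(x), the multiples being successors so that [norm_isoZ]
   applies. *)
have [n ngx] : exists n, g x < n.+1%:R * (f x - g x).
  have d0 : 0 < f x - g x by rewrite subr_gt0.
  exists (Num.truncn (g x / (f x - g x))).
  by rewrite -ltr_pdivrMr// truncnS_gt.
pose U := [set z | n.+2%:R * g z < n.+1%:R * f z].
have oU : open U.
  apply: open_ltfun => z; (apply: cvgM; first exact: cvg_cst).
    exact: gc.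
  exact: C0pos_continuous.
have Ux : U x by rewrite /U /= -natr1; lra.
have [k [Ak kx k1 kU]] := C0pos_bump (R := R) X_lc X_T2 oU Ux.
have Afk := C0posM Af Ak; have Agk := gA k Ak.
have : supnorm (T (fun z => n.+2%:R * (g \* k) z)) <=
       supnorm (T (fun z => n.+1%:R * (f \* k) z)).
  apply: norm_iso_supnorm_le; [exact: C0posZ|exact: C0posZ|].
  move=> z /=; rewrite !mulrA; have [zU|/kU ->] := pselect (U z).
    by rewrite ler_wpM2r ?C0pos_ge0// ltW.
  by rewrite !mulr0.
rewrite !norm_isoZ// !supnormZ//; [|exact: norm_iso_C0pos..].
have := fg k Ak; have := supnorm_ge0 (norm_iso_C0pos Afk).
rewrite -(natr1 n.+1); set a := supnorm _; set b := supnorm _ => a0 ab le_ba.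
have N0 : 0 < n.+1%:R :> R by [].
(* (n + 2) b <= (n + 1) a and a <= b force a = 0. Then f k = 0, so f(x) = 0, against 0 <= g(x) <
   f(x). *)
have /(norm_iso_eq0 Afk)/(congr1 (@^~ x)) : a = 0 by nra.
by rewrite /= kx mulr1; have := g0 x; lra.
Qed.

Lemma norm_iso_unital_order : unital_order_isomorphism T.
Proof.
split; [by case: T_iso| |by move=> n f; exact: norm_isoZ|].
- move=> f g Af Ag; have BTf := norm_iso_C0pos Af; have BTg := norm_iso_C0pos Ag.
  split=> fg.
    apply: norm_iso_le_of_supnorm => //; first exact: C0pos_continuous.
      exact: C0pos_ge0.
    move=> k Ak; rewrite -norm_isoM//.
    apply: norm_iso_supnorm_le; [exact: C0posM|exact: C0posM|].
    by move=> x /=; rewrite ler_wpM2r ?C0pos_ge0.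
  apply: norm_iso_reflect => //; first exact: C0pos_continuous.
  + exact: C0pos_ge0.
  + by move=> k Ak; exact: C0posM.
  move=> k Ak; rewrite !norm_isoM//; have BTk := norm_iso_C0pos Ak.
  apply: le_supnorm; first exact: C0posM.
  by move=> y /=; rewrite mulr_ge0 ?C0pos_ge0//= ler_wpM2r ?C0pos_ge0.
- move=> f Af; have BTf := norm_iso_C0pos Af.
  (* The unit ball is handled as comparison with the constant 1, which may lie outside the cone but
     multiplies it into itself. *)
  have mul1 (Z : Type) (k : Z -> R) : (fun=> 1) \* k = k.
    by apply/funext => z /=; rewrite mul1r.
  split=> f1.
    apply: (@norm_iso_le_of_supnorm _ (fun=> 1)) => //.
      by move=> y; exact: cvg_cst.
    move=> k Ak; rewrite mul1.
    apply: norm_iso_supnorm_le => //; first exact: C0posM.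
    by move=> x /=; rewrite ler_piMl ?C0pos_ge0.
  apply: (@norm_iso_reflect _ (fun=> 1)) => //.
  + by move=> y; exact: cvg_cst.
  + by move=> k; rewrite mul1.
  move=> k Ak; rewrite mul1 norm_isoM//; have BTk := norm_iso_C0pos Ak.
  apply: le_supnorm => // y /=.
  by rewrite mulr_ge0 ?C0pos_ge0//= ler_piMl ?C0pos_ge0.
Qed.

End NormToOrder.

(** * From an order isomorphism to a point map *)

Section PointMap.
Context {R : realType} {X Y : topologicalType} (T : (X -> R) -> (Y -> R)).
Hypothesis T_ord : unital_order_isomorphism T.
Implicit Types f g : X -> R.

Local Notation A := (C0pos R X).
Local Notation B := (C0pos R Y).

Lemma order_iso_C0pos f : A f -> B (T f).
Proof. by case: T_ord => -[+ _ _] _ _ _; apply. Qed.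

Lemma order_iso_surj u : B u -> exists2 f, A f & T f = u.
Proof. by case: T_ord => -[_ _ +] _ _ _ => /[apply]. Qed.

Lemma order_iso_le f g : A f -> A g ->
  (forall x, f x <= g x) <-> (forall y, T f y <= T g y).
Proof. by case: T_ord => _ + _ _; apply. Qed.

(** The pointwise minimum is the infimum in the ordered cone, and order isomorphisms preserve
    infima. *)
Lemma order_iso_min f g : A f -> A g -> T (f \min g) = T f \min T g.
Proof.
move=> Af Ag; have Afg := C0pos_min Af Ag.
have [h Ah Th] := order_iso_surj (C0pos_min (order_iso_C0pos Af) (order_iso_C0pos Ag)).
have hf : forall x, h x <= f x.
  by apply/order_iso_le => // y; rewrite Th /= ge_min lexx.
have hg : forall x, h x <= g x.
  by apply/order_iso_le => // y; rewrite Th /= ge_min lexx orbT.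
have hfg : forall y, T h y <= T (f \min g) y.
  by apply/order_iso_le => // x /=; rewrite le_min hf hg.
have fgf : forall y, T (f \min g) y <= T f y.
  by apply/order_iso_le => // x /=; rewrite ge_min lexx.
have fgg : forall y, T (f \min g) y <= T g y.
  by apply/order_iso_le => // x /=; rewrite ge_min lexx orbT.
apply/funext => y; apply/eqP; rewrite eq_le -[in X in _ && X]Th hfg andbT.
by rewrite /= le_min fgf fgg.
Qed.

Lemma order_isoZ n f : A f ->
  T (fun x => n.+1%:R * f x) = (fun y => n.+1%:R * T f y).
Proof. by case: T_ord => _ _ + _; apply. Qed.

Lemma order_isoZV n f : A f ->
  T (fun x => n.+1%:R^-1 * f x) = (fun y => n.+1%:R^-1 * T f y).
Proof.
move=> Af; have N0 : n.+1%:R != 0 :> R by rewrite pnatr_eq0.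
have ANf : A (fun x => n.+1%:R^-1 * f x) by apply: C0posZ => //; rewrite invr_ge0.
rewrite [in RHS](_ : f = fun x => n.+1%:R * (n.+1%:R^-1 * f x)).
  by rewrite order_isoZ//; apply/funext => y; rewrite mulKf.
by apply/funext => x; rewrite mulVKf.
Qed.

Lemma order_iso_le1 f : A f -> (forall x, f x <= 1) <-> (forall y, T f y <= 1).
Proof. by case: T_ord => _ _ _; apply. Qed.

(* The sets {g >= 1}, for g in the cone with T g (y) > 1, are nonempty since T
   preserves the unit ball, compact, and directed since T preserves minima. *)
Lemma order_iso_dominating_point (Y_lc : locally_compact [set: Y])
    (Y_T2 : hausdorff_space Y) (y : Y) :
  exists x, forall f, A f -> T f y <= f x.
Proof.
pose D := [set g : X -> R | A g /\ 1 < T g y].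
pose E g := [set x : X | 1 <= g x].
have [g0 Dg0] : exists g, D g.
  have [k [Bk ky _ _]] := C0pos_bump (R := R) Y_lc Y_T2 openT (I : setT y).
  have [f Af Tf] := order_iso_surj Bk.
  (* Membership in [D] is strict, and T(f)(y) = 1, hence the factor 2. *)
  exists (fun x => 2 * f x); split; first exact: C0posZ.
  by rewrite order_isoZ// Tf ky; lra.
have FF : ProperFilter (filter_from D E).
  apply: filter_from_proper.
    apply: filter_from_filter; first by exists g0.
    move=> g h [Ag gy] [Ah hy]; exists (g \min h).
      by split; [exact: C0pos_min|rewrite order_iso_min//= lt_min gy hy].
    by move=> x; rewrite /E /= le_min => /andP[].
  move=> g [Ag gy]; apply: contrapT => /set0P/negP/negPn/eqP Eg.
  have /(order_iso_le1 Ag)/(_ y) : forall x, g x <= 1.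
    move=> x; rewrite leNgt; apply/negP => /ltW xg.
    by have : set0 x by rewrite -Eg.
  by rewrite leNgt gy.
(* Compactness of [E g0] yields a cluster point, which lies in every [E g] because these sets are
   closed. *)
have [x [_ xE]] : E g0 `&` cluster (filter_from D E) !=set0.
  have [Ag0 _] := Dg0.
  by apply: (C0pos_compact Ag0 ltr01); exists g0.
have gx g : D g -> 1 <= g x.
  move=> Dg; have [Ag _] := Dg.
  suff : closure (E g) x.
    by rewrite -(closure_id _).1//; exact/closed_superlevel/C0pos_continuous.
  by move=> U xU; apply: xE => //; exists g.
exists x => f Af; rewrite leNgt; apply/negP => fTf.
(* A rational (m + 1)/(n + 1) strictly between f(x) and T(f)(y): [T] is known to commute with
   positive rational factors. Rescaling [f] by its inverse gives a member of [D] below 1 at [x]. *)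
have [n [m [nm mn]]] : exists n m : nat,
    n.+1%:R * f x < m.+1%:R /\ m.+1%:R < n.+1%:R * T f y.
  have d0 : 0 < T f y - f x by rewrite subr_gt0.
  (* The interval from (n + 1) f(x) to (n + 1) T(f)(y) is longer than 1, so it contains the first
     integer above its left end. *)
  pose n := Num.truncn (T f y - f x)^-1.
  have n1 : 1 < n.+1%:R * (T f y - f x).
    by rewrite -ltr_pdivrMr// div1r truncnS_gt.
  have nf0 : 0 <= n.+1%:R * f x by rewrite mulr_ge0// C0pos_ge0.
  exists n, (Num.truncn (n.+1%:R * f x)); split; first exact: truncnS_gt.
  have := truncn_le (n.+1%:R * f x); rewrite nf0 -(natr1 (Num.truncn _)); lra.
have Anf : A (fun x => n.+1%:R * f x) by exact: C0posZ.
have : D (fun x => m.+1%:R^-1 * (n.+1%:R * f x)).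
  split; first by apply: C0posZ; rewrite ?invr_ge0.
  by rewrite order_isoZV// order_isoZ// mulrC ltr_pdivlMr// mul1r.
by move/gx; rewrite mulrC ler_pdivlMr// mul1r leNgt nm.
Qed.

(** Every clause is an equivalence or an equation, so substituting u = T(S(u)) turns the clause for
    [T] into that for [S]. *)
Lemma order_iso_inverse : exists S : (Y -> R) -> (X -> R),
  unital_order_isomorphism S /\ forall f, A f -> S (T f) = f.
Proof.
have /choice[S SP] : forall u, exists f, B u -> A f /\ T f = u.
  move=> u; have [Bu|nBu] := pselect (B u); last by exists (fun=> 0).
  by have [f Af Tf] := order_iso_surj Bu; exists f.
have AS u : B u -> A (S u) by move=> /SP[].
have TS u : B u -> T (S u) = u by move=> /SP[].
have T_inj f g : A f -> A g -> T f = T g -> f = g.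
  by move=> Af Ag; case: T_ord => -[_ + _] _ _ _; apply; rewrite inE.
have ST f : A f -> S (T f) = f.
  by move=> Af; have BTf := order_iso_C0pos Af; apply: T_inj; rewrite ?TS//; exact: AS.
exists S; split=> //; split.
- split; first exact: AS.
    move=> u v; rewrite !inE => Bu Bv Suv; by rewrite -(TS u)// Suv TS.
  by move=> f Af; exists (T f); [exact: order_iso_C0pos|exact: ST].
- move=> u v Bu Bv; rewrite -{1}(TS u)// -{1}(TS v)//.
  by apply: iff_sym; apply: order_iso_le; exact: AS.
- move=> n u Bu; have ASu := AS _ Bu.
  by rewrite -{1}(TS u Bu) -order_isoZ// ST//; exact: C0posZ.
- move=> u Bu; rewrite -{1}(TS u)//.
  by apply: iff_sym; apply: order_iso_le1; exact: AS.
Qed.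

End PointMap.

(** * The two point maps as mutually inverse homeomorphisms *)

Unset Implicit Arguments.
Set Strict Implicit.

Theorem mainTheorem1 (R : realType) (X Y : topologicalType)
    (X_lc : locally_compact [set: X]) (X_T2 : hausdorff_space X)
    (Y_lc : locally_compact [set: Y]) (Y_T2 : hausdorff_space Y)
    (T : (X -> R) -> (Y -> R)) (T_iso : ring_isomorphism_in_norm T) :
  exists tau : Y -> X, homeomorphism tau /\
    forall f : X -> R, C0pos R X f -> forall y : Y, T f y = f (tau y).
Proof.
have T_ord := norm_iso_unital_order X_lc X_T2 Y_lc Y_T2 T_iso.
have [S [S_ord ST]] := order_iso_inverse T_ord.
have /choice[tau tauP] := order_iso_dominating_point T_ord Y_lc Y_T2.
have /choice[sigma sigmaP] := order_iso_dominating_point S_ord X_lc X_T2.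
have sigma_ge f x : C0pos R X f -> f x <= T f (sigma x).
  by move=> Af; rewrite -{1}(ST f Af); apply: sigmaP; exact: order_iso_C0pos.
(* T(f)(y) <= f(tau(y)) <= T(f)(sigma(tau(y))), and T(f) runs through the whole cone of [Y], which
   separates points. *)
have tauK : cancel tau sigma.
  move=> y; apply/esym/(C0pos_separates (R := R) Y_lc Y_T2) => u.
  move=> /(order_iso_surj T_ord)[f Af <-].
  exact: le_trans (tauP y f Af) (sigma_ge _ _ Af).
have sigmaK : cancel sigma tau.
  move=> x; apply/esym/(C0pos_separates (R := R) X_lc X_T2) => f Af.
  exact: le_trans (sigma_ge _ _ Af) (tauP _ _ Af).
have T_tau f y : C0pos R X f -> T f y = f (tau y).
  move=> Af; apply/eqP; rewrite eq_le tauP//=.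
  by rewrite -[in leRHS](tauK y) sigma_ge.
exists tau; split; last by move=> f Af y; exact: T_tau.
exists sigma; split=> //.
  (* Composing with [tau] sends [f] to [T f], and composing with [sigma] sends [T f] back to [f];
     both results are continuous. *)
  apply: (continuous_C0pos (R := R)) => // f Af.
  rewrite (_ : f \o tau = T f); last by apply/funext => y; rewrite /= T_tau.
  exact/C0pos_continuous/(order_iso_C0pos T_ord).
apply: (continuous_C0pos (R := R)) => // _ /(order_iso_surj T_ord)[f Af <-].
rewrite (_ : T f \o sigma = f); last by apply/funext => x; rewrite /= T_tau// sigmaK.
exact: C0pos_continuous.
Qed.
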